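(* Let $M=(G,\chi,\ell)$ be a hypergraph model, and let $\mathfrak{K}(M)$ be the Kripke model associated with $M$. (1) If $M$ belongs to the class $\mathcal{H}_n^{su}$ of all simple and $n$-uniform hypergraph models, then $\mathfrak{K}(M)$ belongs to the class $\mathcal{K}_n^{te}$ of all local and proper doxastic Kripke models that are transitive and Euclidean. (2) If $M$ belongs to the class $\mathcal{H}_n^{sut}$ of all simple, $n$-uniform and tail-complete hypergraph models, then $\mathfrak{K}(M)$ belongs to the class $\mathcal{K}_n^{ste}$ of all local and proper doxastic Kripke models that are serial, transitive and Euclidean.
   Context: Fix a set $\mathcal{A}$ of $n\geq 1$ agents (finite, $|\mathcal{A}|=n$). Each $a\in\mathcal{A}$ has a countable set $\mathsf{Var}_a$ of propositional letters; these sets are pairwise disjoint, and $\mathsf{Var}:=\bigcup_{a\in\mathcal{A}}\mathsf{Var}_a$. Kripke models. A doxastic Kripke model is a triple $(W,R,V)$ with $W\neq\emptyset$ a set, $R$ assigning to each $a\in\mathcal{A}$ a relation $R_a\subseteq W\times W$, and $V:W\to\mathcal{P}(\mathsf{Var})$. It is serial/transitive/Euclidean if every $R_a$ is (serial: for every $u$ there is $v$ with $uR_av$; Euclidean: $uR_av$ and $uR_aw$ imply $vR_aw$). For a relation $S$, $S^{\leftrightarrow}:=S\cup S^{-1}$ and $S^{\equiv}$ is the smallest equivalence relation containing $S$. The model is proper if for all $u\neq v$ in $W$ there is $a\in\mathcal{A}$ with $(u,v)\notin R_a^{\equiv}$. It is local if for all $a\in\mathcal{A}$, $u,v\in W$: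 $(u,v)\in R_a^{\leftrightarrow}$ implies $V(u)\cap\mathsf{Var}_a=V(v)\cap\mathsf{Var}_a$. Hypergraph models. A directed hyperedge over a set $\mathscr{V}$ is a pair $E=(X,Y)$ of finite disjoint (possibly empty) subsets of $\mathscr{V}$; $T(E):=X$ (tail), $H(E):=Y$ (head), $U(E):=T(E)\cup H(E)$. A directed hypergraph is a pair $G=(\mathscr{V}(G),\mathscr{E}(G))$ with $\mathscr{V}(G)$ a non-empty set and $\mathscr{E}(G)$ a set of directed hyperedges over $\mathscr{V}(G)$. $G$ is simple if for all $E_1,E_2\in\mathscr{E}(G)$, $E_1\neq E_2$ implies $U(E_1)\not\subseteq U(E_2)$; $k$-uniform if $|U(E)|=k$ for all $E\in\mathscr{E}(G)$; tail-complete if $\mathscr{V}(G)=\bigcup_{E\in\mathscr{E}(G)}T(E)$. A coloring of $G$ is a map $\chi:\mathscr{V}(G)\to\mathcal{A}$ such that for every $E\in\mathscr{E}(G)$ and all distinct $u,v\in U(E)$, $\chi(u)\neq\chi(v)$. A hypergraph model is a triple $M=(G,\chi,\ell)$ with $G$ a directed hypergraph, $\chi$ a coloring of $G$, and $\ell:\mathscr{V}(G)\to\mathcal{P}(\mathsf{Var})$ such that $\chi(u)=a$ implies $\ell(u)\subseteq\mathsf{Var}_a$. It is simple ($n$-uniform, tail-complete) if $G$ is. For $E\in\mathscr{E}(G)$ put $\ell(E):=\bigcup_{u\in U(E)}\ell(u)$. For $E_1,E_2\in\mathscr{E}(G)$: $E_1\vartriangleright_aE_2$ iff some $u\in U(E_1)\cap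 T(E_2)$ has $\chi(u)=a$. The model $\mathfrak{K}(M)$. For a hypergraph model $M=(G,\chi,\ell)$, the Kripke model associated with $M$ is the triple $\mathfrak{K}(M)=(W,R,V)$ where $W:=\mathscr{E}(G)$; $(E_1,E_2)\in R_a$ iff $E_1\vartriangleright_aE_2$, for all $E_1,E_2\in W$; and $V(E):=\ell(E)$ for all $E\in W$.
   Formalization: Part (1) is proved under the added assumption that G has at least one hyperedge; a hypergraph with no hyperedges is vacuously simple and n-uniform, but its associated triple has no worlds and so is not a Kripke model. *)

(* Defs.v *)
From mathcomp Require Import all_boot finmap.
From mathcomp Require Import boolp classical_sets cardinality.
From Stdlib Require Import Relation_Operators.

Set Implicit Arguments.
Unset Strict Implicit.
Unset Printing Implicit Defensive.

Local Open Scope classical_set_scope.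

(** Throughout, [A] is the set of agents, [P] an ambient type containing the
    propositional letters, and [Var a] the set of letters of agent [a]. *)

(** The bare triples (W, R, V); what makes such a triple a doxastic Kripke model
    is the predicate [is_doxastic_model] below. *)
Record kripke (A : finType) (P : Type) := Kripke {
  world : Type;
  acc : A -> world -> world -> Prop;
  val_at : world -> set P }.

Arguments acc {A P} K a u v : rename.
Arguments val_at {A P} K u : rename.

Section KripkeProperties.
Variables (A : finType) (P : Type) (Var : A -> set P) (K : kripke A P).

Definition is_doxastic_model : Prop :=
  inhabited (world K) /\
  forall u : world K, val_at K u `<=` \bigcup_(a in [set: A]) Var a.

Definition k_serial : Prop :=
  forall (a : A) (u : world K), exists v, acc K a u v.

Definition k_transitive : Prop :=
  forall (a : A) (u v w : world K), acc K a u v -> acc K a v w -> acc K a u w.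

Definition k_euclidean : Prop :=
  forall (a : A) (u v w : world K), acc K a u v -> acc K a u w -> acc K a v w.

Definition sym_closure (W : Type) (S : W -> W -> Prop) (u v : W) : Prop :=
  S u v \/ S v u.

Definition equiv_closure (W : Type) (S : W -> W -> Prop) : W -> W -> Prop :=
  clos_refl_sym_trans W S.

Definition k_proper : Prop :=
  forall u v : world K, u <> v -> exists a : A, ~ equiv_closure (acc K a) u v.

Definition k_local : Prop :=
  forall (a : A) (u v : world K), sym_closure (acc K a) u v ->
    val_at K u `&` Var a = val_at K v `&` Var a.

Definition class_K_te : Prop :=
  [/\ is_doxastic_model, k_local, k_proper, k_transitive & k_euclidean].

Definition class_K_ste : Prop :=
  [/\ is_doxastic_model, k_local, k_proper &
      [/\ k_serial, k_transitive & k_euclidean]].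

End KripkeProperties.

Definition hyperedge (V : choiceType) :=
  {E : {fset V} * {fset V} | [disjoint E.1 & E.2]%fset}.

Definition tail (V : choiceType) (E : hyperedge V) : {fset V} := (val E).1.
Definition head (V : choiceType) (E : hyperedge V) : {fset V} := (val E).2.
Definition support (V : choiceType) (E : hyperedge V) : {fset V} :=
  (tail E `|` head E)%fset.

(** [edges] may be empty; the Kripke triple [kripke_of M] then has no world. *)
Record hypergraph := Hypergraph {
  vertex : choiceType;
  vertex_inhabited : inhabited vertex;
  edges : set (hyperedge vertex) }.

Arguments edges : clear implicits.

Section HypergraphProperties.
Variable G : hypergraph.

Definition simple : Prop :=
  forall E1 E2, edges G E1 -> edges G E2 -> E1 <> E2 ->
    ~~ (support E1 `<=` support E2)%fset.

Definition uniform (k : nat) : Prop :=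
  forall E, edges G E -> #|` support E| = k.

Definition tail_complete : Prop :=
  [set: vertex G] = \bigcup_(E in edges G) [set` tail E].

Definition is_coloring (C : Type) (chi : vertex G -> C) : Prop :=
  forall E, edges G E -> forall u v, u \in support E -> v \in support E ->
    u <> v -> chi u <> chi v.

End HypergraphProperties.

Record hypergraph_model (A : finType) (P : Type) (Var : A -> set P) :=
  HypergraphModel {
    graph :> hypergraph;
    color : vertex graph -> A;
    color_coloring : is_coloring color;
    label : vertex graph -> set P;
    label_sub : forall (u : vertex graph) (a : A),
      color u = a -> label u `<=` Var a }.

Section HypergraphModels.
Variables (A : finType) (P : Type) (Var : A -> set P).
Variable M : hypergraph_model Var.

Definition edge_label (E : hyperedge (vertex M)) : set P :=
  \bigcup_(u in [set` support E]) label u.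

Definition edge_rel (a : A) (E1 E2 : hyperedge (vertex M)) : Prop :=
  exists u : vertex M, u \in (support E1 `&` tail E2)%fset /\ color u = a.

Definition class_H_su (n : nat) : Prop := simple M /\ uniform M n.

Definition class_H_sut (n : nat) : Prop :=
  [/\ simple M, uniform M n & tail_complete M].

(** The worlds form the subtype of hyperedges that belong to [edges M]. *)
Definition kripke_of : kripke A P :=
  {| world := set_type (edges M);
     acc := fun a E1 E2 => edge_rel a (val E1) (val E2);
     val_at := fun E => edge_label (val E) |}.

End HypergraphModels.

(* Main.v *)
(** In an edge each colour occurs at most once, so two edges related by
    [edge_rel a] have the same [a]-coloured vertex; this also holds along the
    generated equivalence. Locality, transitivity and Euclideanness read this
    off directly; if two edges were equivalent for every colour they would have
    the same support, against simplicity. Seriality follows from tail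
    completeness, since uniformity makes every colour occur in every edge. *)

Require Import Defs.
From mathcomp Require Import all_boot finmap.
From mathcomp Require Import boolp classical_sets cardinality.

Set Implicit Arguments.
Unset Strict Implicit.
Unset Printing Implicit Defensive.

Local Open Scope classical_set_scope.

Lemma tail_support (V : choiceType) (E : hyperedge V) (u : V) :
  u \in tail E -> u \in Defs.support E.
Proof. by move=> uE; rewrite in_fsetU uE. Qed.

Lemma color_support_inj (A : finType) (P : Type) (Var : A -> set P)
    (M : hypergraph_model Var) (E : hyperedge (vertex M)) (u v : vertex M) :
  edges M E -> u \in Defs.support E -> v \in Defs.support E ->
  color u = color v -> u = v.
Proof.
move=> EM uE vE uv; apply: contrapT => /(color_coloring EM uE vE); exact.
Qed.

(** The vertex witnessing [edge_rel] lies in both supports and is the only one of colour [a] in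
    each. The form as an equality of booleans lets it be reversed and chained along the generated
    equivalence. *)
Lemma edge_rel_support (A : finType) (P : Type) (Var : A -> set P)
    (M : hypergraph_model Var) (a : A) (E1 E2 : hyperedge (vertex M))
    (v : vertex M) :
  edges M E1 -> edges M E2 -> edge_rel a E1 E2 -> color v = a ->
  (v \in Defs.support E1) = (v \in Defs.support E2).
Proof.
move=> E1M E2M [u [/fsetIP[uE1 /tail_support uE2] ua]] va.
have uv : color u = color v by rewrite ua va.
by apply/idP/idP => vE; [rewrite -(color_support_inj E1M uE1 vE uv)
                        | rewrite -(color_support_inj E2M uE2 vE uv)].
Qed.

Lemma equiv_edge_rel_support (A : finType) (P : Type) (Var : A -> set P)
    (M : hypergraph_model Var) (a : A) (E1 E2 : world (kripke_of M))
    (v : vertex M) :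
  equiv_closure (acc (kripke_of M) a) E1 E2 -> color v = a ->
  (v \in Defs.support (val E1)) = (v \in Defs.support (val E2)).
Proof.
move=> E12 va; elim: E12 => [F1 F2 F12|//|F1 F2 _ ->//|F1 F2 F3 _ -> _ ->//].
exact: edge_rel_support (set_valP F1) (set_valP F2) F12 va.
Qed.

(** Pigeonhole: the colouring is injective on a support, which has as many elements as [A], hence it
    is onto. *)
Lemma color_surj_support (A : finType) (P : Type) (Var : A -> set P)
    (M : hypergraph_model Var) (E : hyperedge (vertex M)) (a : A) :
  edges M E -> #|` Defs.support E| = #|A| ->
  exists2 u, u \in Defs.support E & color u = a.
Proof.
move=> EM cardE; pose f (u : Defs.support E) := color (val u).
have f_inj : injective f.
  by move=> u v uv; apply/val_inj/(color_support_inj EM (valP u) (valP v) uv).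
have /codomP[u ->] : a \in codom f.
  by apply: inj_card_onto => //; rewrite -cardfE cardE.
by exists (val u) => //; exact: valP.
Qed.

Lemma edge_label_sub (A : finType) (P : Type) (Var : A -> set P)
    (M : hypergraph_model Var) (E : hyperedge (vertex M)) :
  edge_label E `<=` \bigcup_(a in [set: A]) Var a.
Proof. by move=> p [u _ up]; exists (color u) => //; exact: label_sub up. Qed.

Lemma edge_label_local_sub (A : finType) (P : Type) (Var : A -> set P)
    (M : hypergraph_model Var) (a : A) (E1 E2 : hyperedge (vertex M)) :
  trivIset [set: A] Var ->
  (forall v : vertex M, color v = a ->
    v \in Defs.support E1 -> v \in Defs.support E2) ->
  edge_label E1 `&` Var a `<=` edge_label E2 `&` Var a.
Proof.
move=> VarI E12 p [[u uE1 up] ap]; split=> //; exists u => //; apply: E12 => //.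
(* The letter [p] lies in both [Var (color u)] and [Var a], so disjointness forces [color u = a]. *)
apply: VarI => //; exists p; split=> //; exact: label_sub up.
Qed.

Lemma kripke_of_local (A : finType) (P : Type) (Var : A -> set P)
    (M : hypergraph_model Var) :
  trivIset [set: A] Var -> k_local Var (kripke_of M).
Proof.
move=> VarI a E1 E2 E12.
have E v : color v = a ->
    (v \in Defs.support (val E1)) = (v \in Defs.support (val E2)).
  case: E12 => E12 va; [|symmetry];
  by apply: edge_rel_support E12 va; exact: set_valP.
by apply/seteqP; split; apply: edge_label_local_sub => // v /E ->.
Qed.

Lemma kripke_of_proper (A : finType) (P : Type) (Var : A -> set P)
    (M : hypergraph_model Var) :
  simple M -> k_proper (kripke_of M).
Proof.
move=> simpleM E1 E2 neq12; apply/existsNP => E12.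
have /negP[] : ~~ (Defs.support (val E1) `<=` Defs.support (val E2))%fset.
  apply: simpleM; [exact: set_valP..|].
  by move=> /val_inj.
(* Each vertex is transferred by the equivalence for its own colour. *)
by apply/fsubsetP => v; rewrite (equiv_edge_rel_support (E12 (color v)) erefl).
Qed.

Lemma kripke_of_transitive (A : finType) (P : Type) (Var : A -> set P)
    (M : hypergraph_model Var) : k_transitive (kripke_of M).
Proof.
move=> a E1 E2 E3 E12 [v [/fsetIP[vE2 vE3] va]].
(* The witness of the second relation serves again: [E12] carries it from [E2] back to [E1]. *)
exists v; split=> //; apply/fsetIP; split=> //.
by rewrite (edge_rel_support (set_valP E1) (set_valP E2) E12 va).
Qed.

Lemma kripke_of_euclidean (A : finType) (P : Type) (Var : A -> set P)
    (M : hypergraph_model Var) : k_euclidean (kripke_of M).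
Proof.
move=> a E1 E2 E3 E12 [v [/fsetIP[vE1 vE3] va]].
(* Here [E12] carries the witness forward, from [E1] to [E2]. *)
exists v; split=> //; apply/fsetIP; split=> //.
by rewrite -(edge_rel_support (set_valP E1) (set_valP E2) E12 va).
Qed.

Lemma kripke_of_serial (A : finType) (P : Type) (Var : A -> set P)
    (M : hypergraph_model Var) :
  uniform M #|A| -> tail_complete M -> k_serial (kripke_of M).
Proof.
move=> uniM tcM a E; have EM := set_valP E.
have [u uE ua] := color_surj_support a EM (uniM _ EM).
(* An edge with the [a]-coloured vertex [u] of [E] in its tail is the successor sought. *)
have [F FM uF] : (\bigcup_(E in edges M) [set` tail E]) u by rewrite -tcM.
exists (SigSub (mem_set FM)), u; split=> //; exact/fsetIP.
Qed.

(** Provides a world in the tail-complete case: there is a vertex, and it lies in the tail of some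
    edge. *)
Lemma tail_complete_edges_neq0 (G : hypergraph) :
  tail_complete G -> edges G !=set0.
Proof.
move=> tcG; have [u] := vertex_inhabited G.
have [E EG _] : (\bigcup_(E in edges G) [set` tail E]) u by rewrite -tcG.
by exists E.
Qed.

Lemma kripke_of_doxastic (A : finType) (P : Type) (Var : A -> set P)
    (M : hypergraph_model Var) :
  edges M !=set0 -> is_doxastic_model Var (kripke_of M).
Proof.
move=> [E EM]; split; first exact: (inhabits (SigSub (mem_set EM))).
by move=> F; exact: edge_label_sub.
Qed.

Theorem proposition5 (n : nat) (n_ge1 : (1 <= n)%N)
    (A : finType) (card_A : #|A| = n)
    (P : Type) (Var : A -> set P)
    (Var_countable : forall a : A, countable (Var a))
    (Var_disjoint : trivIset [set: A] Var)
    (M : hypergraph_model Var) :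
  (edges M !=set0 -> class_H_su M n -> class_K_te Var (kripke_of M)) /\
  (class_H_sut M n -> class_K_ste Var (kripke_of M)).
Proof.
split=> [M0 [simpleM _]|[simpleM uniM tcM]].
  split; [exact: kripke_of_doxastic|exact: kripke_of_local
         |exact: kripke_of_proper|exact: kripke_of_transitive
         |exact: kripke_of_euclidean].
split; [exact/kripke_of_doxastic/tail_complete_edges_neq0
       |exact: kripke_of_local|exact: kripke_of_proper|].
split; [|exact: kripke_of_transitive|exact: kripke_of_euclidean].
by apply: kripke_of_serial => //; rewrite card_A.
Qed.
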